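(* Suppose that the basis functions $\phi_1,\dots,\phi_k$ are convex and $\Gamma\subseteq\mathbb{R}^k_{\geq 0}$. - Then $\phi^\gamma$ is convex for all $\gamma\in\Gamma$, and $\phi^+(\cdot;\Gamma)$ is a finite-valued convex function. - If, in addition, the functions $\phi_1,\dots,\phi_k$ are strictly convex and $0\notin\Gamma$, then $\phi^\gamma$ is strictly convex for all $\gamma\in\Gamma$, and $\phi^+(\cdot;\Gamma)$ is strictly convex.
   Context: Conventions: $\mathbb{R}^k_{\geq 0}$ is the set of vectors in $\mathbb{R}^k$ with all entries nonnegative. For a symmetric matrix $P$, $P\geq 0$ (resp. $P>0$) means positive semidefinite (resp. definite); $P<0$ means $-P>0$. Let $\phi_1,\dots,\phi_k:\mathbb{R}^n\to\mathbb{R}$ be known basis functions, $b(z):=(\phi_1(z),\dots,\phi_k(z))^\top\in\mathbb{R}^k$, and for $\gamma\in\mathbb{R}^k$ let $\phi^\gamma(z):=\gamma^\top b(z)$. For a symmetric matrix $\Pi=\begin{bmatrix}\Pi_{11}&\Pi_{12}\\ \Pi_{21}&\Pi_{22}\end{bmatrix}\in\mathbb{R}^{(1+\ell)\times(1+\ell)}$ with $\Pi_{11}\in\mathbb{R}$, $\Pi_{22}\in\mathbb{R}^{\ell\times\ell}$, define $\mathcal{Z}(\Pi):=\{v\in\mathbb{R}^\ell \mid \begin{bmatrix}1\\ v\end{bmatrix}^\top\Pi\begin{bmatrix}1\\ v\end{bmatrix}\geq 0\}$; if $\Pi_{22}<0$, the Schur complement is $\Pi|\Pi_{22}:=\Pi_{11}-\Pi_{12}\Pi_{22}^{-1}\Pi_{21}$.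 Measurements: fix points $z_1,\dots,z_T\in\mathbb{R}^n$ and put $\Phi:=[\,b(z_1)\ \cdots\ b(z_T)\,]\in\mathbb{R}^{k\times T}$. There is an unknown true parameter $\hat\gamma\in\mathbb{R}^k$ and an unknown noise $W\in\mathbb{R}^{1\times T}$ such that the measured data satisfy $Y=\hat\gamma^\top\Phi+W\in\mathbb{R}^{1\times T}$. Standing noise assumption: $\Pi\in\mathbb{R}^{(1+T)\times(1+T)}$ is symmetric with $\Pi_{22}<0$ and $\Pi|\Pi_{22}\geq 0$, and $W^\top\in\mathcal{Z}(\Pi)$. The set of parameters consistent with the measurements is $\Gamma:=\{\gamma\in\mathbb{R}^k\mid Y=\gamma^\top\Phi+W' \text{ for some } W' \text{ with } (W')^\top\in\mathcal{Z}(\Pi)\}$. It equals $\mathcal{Z}(N)$, where $$N:=\begin{bmatrix}1&Y\\0&-\Phi\end{bmatrix}\Pi\begin{bmatrix}1&Y\\0&-\Phi\end{bmatrix}^\top\in\mathbb{R}^{(1+k)\times(1+k)}.$$ In particular $\hat\gamma\in\Gamma$. Define $\phi^+(z;\Gamma):=\sup_{\gamma\in\Gamma}\phi^\gamma(z)$. *)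

(* Defs.v *)
From HB Require Import structures.
From mathcomp Require Import all_boot all_order all_algebra.
From mathcomp Require Import interval_inference.
From mathcomp Require Import boolp classical_sets reals ereal convex.

Set Implicit Arguments.
Unset Strict Implicit.
Unset Printing Implicit Defensive.

Import Order.TTheory GRing.Theory Num.Theory.

Local Open Scope classical_set_scope.
Local Open Scope convex_scope.
Local Open Scope ring_scope.

(* Strict version of the library's [convex_function]. *)
Definition strictly_convex_function (R : numFieldType) (E : lmodType R)
    (E' := convex_lmodType E) (D : set E') (f : E' -> R^o) : Prop :=
  forall t : {i01 R}, 0 < t%:num -> t%:num < 1 ->
    {in D &, forall x y : E', x != y -> f (x <| t |> y) < f x <| t |> f y}.

Definition posdefmx (R : realType) (m : nat) (P : 'M[R]_m) : Prop :=
  P^T = P /\ forall v : 'cV[R]_m, v != 0 -> 0 < (v^T *m P *m v) 0 0.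

Definition negdefmx (R : realType) (m : nat) (P : 'M[R]_m) : Prop :=
  posdefmx (- P).

Definition Zset (R : realType) (l : nat) (Pi : 'M[R]_(1 + l)) : set 'cV[R]_l :=
  [set v | 0 <= ((col_mx 1%:M v)^T *m Pi *m col_mx 1%:M v) 0 0].

(* The Schur complement Pi | Pi22, meaningful when Pi22 is invertible. *)
Definition schur_compl (R : realType) (l : nat) (Pi : 'M[R]_(1 + l)) : R :=
  (ulsubmx Pi - ursubmx Pi *m invmx (drsubmx Pi) *m dlsubmx Pi) 0 0.

Section BasisFunctions.
Variables (R : realType) (n k : nat) (phi : 'I_k -> 'cV[R]_n -> R).

Definition basis_vec (z : 'cV[R]_n) : 'cV[R]_k := \col_i phi i z.

Definition phi_param (g : 'cV[R]_k) (z : 'cV[R]_n) : R :=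
  (g^T *m basis_vec z) 0 0.

Definition data_mx (T : nat) (z : 'I_T -> 'cV[R]_n) : 'M[R]_(k, T) :=
  \matrix_(i < k, t < T) basis_vec (z t) i 0.

(* The supremum is taken in the extended reals: the real-valued [sup] is 0 on
   unbounded sets, which would make finiteness vacuous. *)
Definition phi_plus (G : set 'cV[R]_k) (z : 'cV[R]_n) : \bar R :=
  ereal_sup [set (phi_param g z)%:E | g in G].

End BasisFunctions.

Definition consistent_set (R : realType) (k T : nat) (Pi : 'M[R]_(1 + T))
    (Phi : 'M[R]_(k, T)) (Y : 'rV[R]_T) : set 'cV[R]_k :=
  [set g | exists W' : 'rV[R]_T, Zset Pi W'^T /\ Y = g^T *m Phi + W'].

(* Main.v *)
Require Import Defs.
From HB Require Import structures.
From mathcomp Require Import all_boot all_order all_algebra.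
From mathcomp Require Import interval_inference ring lra.
From mathcomp Require Import boolp classical_sets reals ereal convex.

Set Implicit Arguments.
Unset Strict Implicit.
Unset Printing Implicit Defensive.

Import Order.TTheory GRing.Theory Num.Theory.

Local Open Scope classical_set_scope.
Local Open Scope ring_scope.

(** Write q for the quadratic function whose superlevel set q >= 0 is Z(Pi).
    Since Pi22 < 0, q is strictly concave, so it lies below each of its tangent
    planes ([noise_form_le_tangent]). The boundedness of Gamma and its
    separation from 0 both come from a choice of the point of tangency.

    Finiteness. The slope of the tangent at v0 is 2 (Pi12 + v0^T Pi22); as Pi22
    is invertible, v0 can be chosen so that this is any prescribed row vector,
    and so every linear functional is bounded above on Z(Pi)
    ([Zset_linear_ub]). Moreover Gamma contains the whole line gamma + c v as
    soon as v^T Phi = 0, and a line inside the nonnegative orthant is a point;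
    hence Phi has full row rank ([consistent_set_row_free]). So gamma is an
    affine function of the noise W' = Y - gamma^T Phi, and the linear
    functional gamma |-> phi^gamma(x) is bounded above on Gamma.

    Convexity. With nonnegative weights, phi^gamma is convex, and a pointwise
    supremum of convex functions is convex.

    Strict convexity. A supremum of strictly convex functions need not be
    strictly convex, so a gap uniform over Gamma is needed. If 0 is not in
    Gamma, then q < 0 at the noise Y^T that the parameter 0 would require, and
    the tangent there separates 0 from Gamma: some linear functional is at
    least c > 0 on Gamma ([consistent_set_separate0]). On the nonnegative
    orthant any functional with positive coefficients dominates a positive
    multiple of it ([nneg_comb_lb]); applied to the convexity gaps of the
    phi_i at given x <> y and t, this bounds the convexity gap of phi^gamma
    away from 0 for all gamma in Gamma at once. The bound survives the
    supremum. *)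

(** * The noise set *)

Section NoiseSet.
Variables (R : realType) (l : nat).
Implicit Types (Pi : 'M[R]_(1 + l)) (v : 'cV[R]_l).

Definition noise_form Pi v : R :=
  ((col_mx 1%:M v)^T *m Pi *m col_mx 1%:M v) 0 0.

Lemma noise_formE Pi v : Pi^T = Pi ->
  noise_form Pi v = ulsubmx Pi 0 0 + 2 * (ursubmx Pi *m v) 0 0
                    + (v^T *m drsubmx Pi *m v) 0 0.
Proof.
move=> Pi_sym; rewrite /noise_form -{1}[Pi]submxK tr_col_mx mul_row_block.
rewrite mul_row_col trmx1 !mul1mx mulmx1.
have -> : v^T *m dlsubmx Pi = (ursubmx Pi *m v)^T.
  by rewrite trmx_mul trmx_ursub Pi_sym.
by rewrite mulmxDl !mxE; ring.
Qed.

(** A concave function lies below its tangents: the error of the first-order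
    expansion at v0 is d^T Pi22 d <= 0 with d = v - v0. *)
Lemma noise_form_le_tangent Pi v0 v : Pi^T = Pi -> negdefmx (drsubmx Pi) ->
  noise_form Pi v <= noise_form Pi v0
    + 2 * ((ursubmx Pi + v0^T *m drsubmx Pi) *m (v - v0)) 0 0.
Proof.
move=> Pi_sym [_ Pi22_neg]; rewrite !noise_formE //.
set A := ursubmx Pi; set P := drsubmx Pi.
have [d ->] : exists d, v = v0 + d by exists (v - v0); rewrite subrKC.
rewrite [v0 + d - v0]addrAC subrr add0r.
have cross : (d^T *m P *m v0) 0 0 = (v0^T *m P *m d) 0 0.
  have -> : d^T *m P *m v0 = (v0^T *m P *m d)^T.
    by rewrite !trmx_mul trmxK trmx_drsub Pi_sym mulmxA.
  by rewrite mxE.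
have dPd : (d^T *m P *m d) 0 0 <= 0.
  have [->|d0] := eqVneq d 0; first by rewrite mulmx0 mxE.
  by have := Pi22_neg d d0; rewrite mulmxN mulNmx mxE oppr_gt0 => /ltW.
have addE (M N : 'M[R]_1) : (M + N) 0 0 = M 0 0 + N 0 0 by rewrite mxE.
rewrite [(v0 + d)^T]linearD /= !mulmxDr !mulmxDl !addE cross; lra.
Qed.

Lemma negdefmx_unit (P : 'M[R]_l) : negdefmx P -> P \in unitmx.
Proof.
move=> [_ P_neg]; rewrite unitmxE unitfE; apply/negP => /det0P[u u0 uP].
have uT0 : u^T != 0.
  by apply: contra u0 => /eqP/(congr1 trmx); rewrite trmxK trmx0 => ->.
by have := P_neg _ uT0; rewrite trmxK mulmxN uP oppr0 mul0mx mxE ltxx.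
Qed.

(** The tangent at v0 bounds the functional - 2 (Pi12 + v0^T Pi22) on Z(Pi);
    solving for v0 reaches every functional. *)
Lemma Zset_linear_ub Pi (a : 'rV[R]_l) : Pi^T = Pi ->
  negdefmx (drsubmx Pi) ->
  exists C, forall v, Zset Pi v -> (a *m v) 0 0 <= C.
Proof.
move=> Pi_sym Pi22_neg; have Pi22_unit := negdefmx_unit Pi22_neg.
pose v0 := ((- (2^-1 *: a) - ursubmx Pi) *m invmx (drsubmx Pi))^T.
have slope : ursubmx Pi + v0^T *m drsubmx Pi = - (2^-1 *: a).
  by rewrite trmxK mulmxKV // subrKC.
exists (noise_form Pi v0 + (a *m v0) 0 0) => v; rewrite /Zset /= => Zv.
have := le_trans Zv (noise_form_le_tangent v0 v Pi_sym Pi22_neg).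
rewrite slope mulNmx -scalemxAl mulmxBr; set f := noise_form Pi v0.
set p := a *m v; set q := a *m v0; rewrite !mxE; lra.
Qed.

End NoiseSet.

(** * The set of consistent parameters *)

Section ConsistentSet.
Variables (R : realType) (k T : nat).
Variables (Pi : 'M[R]_(1 + T)) (Phi : 'M[R]_(k, T)) (Y : 'rV[R]_T).
Hypotheses (Pi_sym : Pi^T = Pi) (Pi22_neg : negdefmx (drsubmx Pi)).

Local Notation Gamma := (consistent_set Pi Phi Y).

Lemma consistent_setP g : Gamma g <-> Zset Pi (Y - g^T *m Phi)^T.
Proof.
split=> [[W' [ZW' ->]]|ZW]; first by rewrite addrAC subrr add0r.
by exists (Y - g^T *m Phi); rewrite subrKC.
Qed.

(** A vector v with v^T Phi = 0 is the direction of a line inside Gamma, on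
    which an entry v_i <> 0 would make the i-th coordinate take the value
    -1. *)
Lemma consistent_set_row_free g0 : Gamma g0 ->
  Gamma `<=` [set g | forall i, 0 <= g i 0] -> row_free Phi.
Proof.
move=> Gg0 Gamma_nneg; apply: inj_row_free => v vPhi.
apply/rowP => i; rewrite [RHS]mxE; apply/eqP; apply: contraT => vi0.
have /Gamma_nneg /(_ i) :
    Gamma (g0 - ((g0 i 0 + 1) / v 0 i) *: v^T).
  apply/consistent_setP.
  rewrite [in X in X *m _]linearB linearZ /= trmxK.
  rewrite mulmxBl -scalemxAl vPhi scaler0 subr0.
  exact/consistent_setP.
by rewrite !mxE divfK // opprD addNKr oppr_ge0 ler10.
Qed.

(** When Phi is right invertible, gamma is an affine function of the noise, so
    boundedness is inherited from Z(Pi). *)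
Lemma consistent_set_linear_ub (b : 'cV[R]_k) : row_free Phi ->
  exists C, forall g, Gamma g -> (g^T *m b) 0 0 <= C.
Proof.
move=> /row_freeP[B PhiB].
have [C ubC] := Zset_linear_ub (- (B *m b)^T) Pi_sym Pi22_neg.
exists (C + (Y *m (B *m b)) 0 0) => g /consistent_setP /ubC.
rewrite mulNmx -trmx_mul mulmxBl -mulmxA (mulmxA Phi) PhiB mul1mx.
set p := Y *m _; set q := g^T *m b; rewrite !mxE; lra.
Qed.

(** The separating functional comes from the tangent to the noise form at Y^T,
    the noise that the parameter 0 would require. *)
Lemma consistent_set_separate0 : ~ Gamma 0 ->
  exists a : 'cV[R]_k, exists2 c, 0 < c &
    forall g, Gamma g -> c <= (g^T *m a) 0 0.
Proof.
move=> G0; pose s := ursubmx Pi + Y *m drsubmx Pi.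
exists ((- 2) *: (Phi *m s^T)), (- noise_form Pi Y^T).
  rewrite oppr_gt0 ltNge; apply/negP => ZY.
  by apply: G0; apply/consistent_setP; rewrite trmx0 mul0mx subr0.
move=> g /consistent_setP Zg.
have := le_trans Zg (noise_form_le_tangent Y^T _ Pi_sym Pi22_neg).
rewrite trmxK -/s -[_^T - _]linearB /= addrAC subrr add0r linearN /= mulmxN.
have -> : s *m (g^T *m Phi)^T = (g^T *m (Phi *m s^T))^T.
  by rewrite !trmx_mul !trmxK mulmxA.
rewrite -scalemxAr; move: (g^T *m _) (noise_form _ _) => p f.
rewrite !mxE; lra.
Qed.

End ConsistentSet.

(** The witness works because e |a_i| <= c d_i for every i. *)
Lemma nneg_comb_lb (R : realType) (k : nat) (a : 'cV[R]_k) (d : 'I_k -> R)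
    (c : R) : 0 < c -> (forall i, 0 < d i) ->
  exists2 e, 0 < e & forall g : 'cV[R]_k, (forall i, 0 <= g i 0) ->
    c <= (g^T *m a) 0 0 -> e <= \sum_i g i 0 * d i.
Proof.
move=> c0 d0; pose S := 1 + \sum_i `|a i 0| / d i.
have r0 i : 0 <= `|a i 0| / d i by rewrite divr_ge0 // ltW.
have S0 : 0 < S by rewrite ltr_pwDl // sumr_ge0.
exists (c / S); first by rewrite divr_gt0.
move=> g g0; rewrite ler_pdivrMr // => /le_trans; apply.
rewrite mxE mulr_suml; apply: ler_sum => i _; rewrite mxE -mulrA.
apply: ler_wpM2l; first exact: g0.
apply: le_trans (ler_norm _) _; rewrite mulrC -ler_pdivrMr //.
by rewrite /S (bigD1 i) //= addrCA lerDl addr_ge0 // sumr_ge0.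
Qed.

(** * Parametrized functions and their supremum *)

Section Supremum.
Variables (R : realType) (n k : nat) (phi : 'I_k -> 'cV[R]_n -> R).
Local Open Scope convex_scope.

Lemma phi_paramE g x : phi_param phi g x = \sum_i g i 0 * phi i x.
Proof. by rewrite /phi_param mxE; apply: eq_bigr => i _; rewrite !mxE. Qed.

Lemma phi_param_gap g (t : {i01 R}) (x y : convex_lmodType 'cV[R]_n) :
  (phi_param phi g x : R^o) <| t |> phi_param phi g y
    - phi_param phi g (x <| t |> y)
  = \sum_i g i 0 * ((phi i x : R^o) <| t |> phi i y - phi i (x <| t |> y)).
Proof.
rewrite convRE !phi_paramE !mulr_sumr -big_split -sumrB /=.
by apply: eq_bigr => i _; rewrite convRE; ring.
Qed.

Lemma phi_param_convex (g : 'cV[R]_k) : (forall i, 0 <= g i 0) ->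
  (forall i, convex_function setT (phi i)) ->
  convex_function setT (phi_param phi g).
Proof.
move=> g0 phi_cvx t x y xT yT; rewrite -subr_ge0 phi_param_gap.
by apply: sumr_ge0 => i _; rewrite mulr_ge0 // subr_ge0 phi_cvx.
Qed.

Section Bounded.
Variable G : set 'cV[R]_k.
Hypotheses (G0 : G !=set0)
  (Gub : forall x, exists C, forall g, G g -> phi_param phi g x <= C).

Lemma phi_plus_fin_num x : phi_plus phi G x \is a fin_num.
Proof.
have [g Gg] := G0; have [C ubC] := Gub x.
have lb : ((phi_param phi g x)%:E <= phi_plus phi G x)%E.
  by apply: ereal_sup_ubound; exists g.
have ub : (phi_plus phi G x <= C%:E)%E.
  by apply: ge_ereal_sup => _ [h Gh <-]; rewrite lee_fin ubC.
rewrite fin_numElt (lt_le_trans (ltNyr _) lb).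
exact: le_lt_trans ub (ltry _).
Qed.

Lemma phi_plus_ub g x : G g -> phi_param phi g x <= fine (phi_plus phi G x).
Proof.
move=> Gg; rewrite -lee_fin fineK ?phi_plus_fin_num //.
by apply: ereal_sup_ubound; exists g.
Qed.

Lemma phi_plus_le x c : (forall g, G g -> phi_param phi g x <= c) ->
  fine (phi_plus phi G x) <= c.
Proof.
move=> ubc; rewrite -lee_fin fineK ?phi_plus_fin_num //.
by apply: ge_ereal_sup => _ [h Gh <-]; rewrite lee_fin ubc.
Qed.

(** A convexity gap e common to all the members of a family is also a
    convexity gap of their supremum. *)
Lemma phi_plus_conv_gap e (t : {i01 R}) (x y : convex_lmodType 'cV[R]_n) :
  (forall g, G g -> phi_param phi g (x <| t |> y) + e
     <= (phi_param phi g x : R^o) <| t |> phi_param phi g y) ->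
  fine (phi_plus phi G (x <| t |> y)) + e
    <= (fine (phi_plus phi G x) : R^o) <| t |> fine (phi_plus phi G y).
Proof.
move=> gap; rewrite -lerBrDr; apply: phi_plus_le => g Gg.
rewrite lerBrDr; apply: le_trans (gap g Gg) _; rewrite !convRE.
by apply: lerD; apply: ler_wpM2l; rewrite ?subr_ge0 //; apply: phi_plus_ub.
Qed.

End Bounded.
End Supremum.

Theorem mainTheorem5 (R : realType) (n k T : nat)
    (phi : 'I_k -> 'cV[R]_n -> R) (z : 'I_T -> 'cV[R]_n)
    (gamma_hat : 'cV[R]_k) (W Y : 'rV[R]_T) (Pi : 'M[R]_(1 + T))
    (Phi := data_mx phi z) (Gamma := consistent_set Pi Phi Y)
    (Y_data : Y = gamma_hat^T *m Phi + W)
    (Pi_sym : Pi^T = Pi)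
    (Pi22_neg : negdefmx (drsubmx Pi))
    (Pi_schur : 0 <= schur_compl Pi)
    (W_noise : Zset Pi W^T)
    (phi_convex : forall i, convex_function setT (phi i))
    (Gamma_nneg : Gamma `<=` [set g : 'cV[R]_k | forall i, 0 <= g i 0]) :
  ((forall g, Gamma g -> convex_function setT (phi_param phi g)) /\
   (forall x, phi_plus phi Gamma x \is a fin_num) /\
   convex_function setT (fun x => fine (phi_plus phi Gamma x))) /\
  ((forall i, strictly_convex_function setT (phi i)) -> ~ Gamma 0 ->
   (forall g, Gamma g -> strictly_convex_function setT (phi_param phi g)) /\
   strictly_convex_function setT (fun x => fine (phi_plus phi Gamma x))).
Proof.
have Ghat : Gamma gamma_hat by exists W.
have Gub x : exists C, forall g, Gamma g -> phi_param phi g x <= C.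
  apply: consistent_set_linear_ub => //.
  exact: consistent_set_row_free Ghat Gamma_nneg.
have G0 : Gamma !=set0 by exists gamma_hat.
have param_convex g : Gamma g -> convex_function setT (phi_param phi g).
  by move=> /Gamma_nneg g0; apply: phi_param_convex.
split.
  split=> //; split; first exact: phi_plus_fin_num.
  move=> t x y xT yT; rewrite -[leLHS]addr0.
  by apply: phi_plus_conv_gap => // g Gg; rewrite addr0 param_convex.
move=> phi_strict Gamma0.
have [a [c c0 sep]] := consistent_set_separate0 Pi_sym Pi22_neg Gamma0.
have gap (t : {i01 R}) (x y : convex_lmodType 'cV[R]_n) :
    0 < t%:num -> t%:num < 1 -> x != y ->
    exists2 e, 0 < e & forall g, Gamma g ->
      phi_param phi g (conv t x y) + e
        <= conv t (phi_param phi g x : R^o) (phi_param phi g y).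
  move=> t0 t1 xy.
  pose d i := conv t (phi i x : R^o) (phi i y) - phi i (conv t x y).
  have d0 i : 0 < d i by rewrite subr_gt0 phi_strict ?in_setT.
  have [e e0 lb] := nneg_comb_lb a c0 d0.
  exists e => // g Gg; rewrite addrC -lerBrDr phi_param_gap.
  by apply: lb; [exact: Gamma_nneg | exact: sep].
split=> [g Gg|] t t0 t1 x y _ _ xy; have [e e0 gap_e] := gap t x y t0 t1 xy.
  by apply: lt_le_trans (gap_e g Gg); rewrite ltrDl.
apply: lt_le_trans (phi_plus_conv_gap G0 Gub gap_e).
by rewrite ltrDl.
Qed.
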